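(* Let $A_n$ denote the set of permutations in $\mathcal{S}_n$ which avoid both patterns $213$ and $231$. For all $n\ge 1$, $$\sum_{\pi\in A_n}\mathrm{sign}(\pi)\,q^{\mathrm{lis}(\pi)}=q\,(q+1)^{\lfloor (n-1)/2\rfloor}(q-1)^{\lfloor n/2\rfloor}.$$ In particular, there are as many even as odd permutations in $A_n$.
   Context: $\mathcal{S}_n$ is the symmetric group on $\{1,\ldots,n\}$. A permutation $\pi\in\mathcal{S}_n$ (written in one-line notation $\pi_1\cdots\pi_n$) avoids the pattern $\tau\in\mathcal{S}_k$ if there is no sequence $1\le i_1<i_2<\cdots<i_k\le n$ such that $\pi_{i_1},\pi_{i_2},\ldots,\pi_{i_k}$ are in the same relative order as $\tau_1,\tau_2,\ldots,\tau_k$. Here $\mathrm{sign}(\pi)$ is the usual sign of $\pi$, $\mathrm{lis}(\pi)$ is the length of the longest increasing subsequence of $\pi_1\cdots\pi_n$, and $q$ is an indeterminate.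
   Formalization: The final claim, that A_n has as many even as odd permutations, is stated only for n ≥ 2, because it fails at n = 1: A_1 contains only the identity, which is even. The identity is stated for all n ≥ 1. *)

(* Defs.v *)
From mathcomp Require Import all_boot all_order all_fingroup all_algebra.

Set Implicit Arguments.
Unset Strict Implicit.
Unset Printing Implicit Defensive.

Local Open Scope nat_scope.

(* Positions and values of a permutation in 'S_n range over {0, ..., n-1}:
   they are those of the one-line notation shifted down by one. *)

(* f lists the positions i_1 < ... < i_k of an occurrence of tau in pi. *)
Definition occurrence (k n : nat) (tau : 'S_k) (pi : 'S_n)
    (f : {ffun 'I_k -> 'I_n}) : bool :=
  [forall i : 'I_k, forall j : 'I_k,
     ((i < j) ==> (f i < f j)) && ((pi (f i) < pi (f j)) == (tau i < tau j))].

Definition avoids (k n : nat) (tau : 'S_k) (pi : 'S_n) : bool :=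
  ~~ [exists f : {ffun 'I_k -> 'I_n}, occurrence tau pi f].

Definition o0 : 'I_3 := @Ordinal 3 0 isT.
Definition o1 : 'I_3 := @Ordinal 3 1 isT.
Definition o2 : 'I_3 := @Ordinal 3 2 isT.

Lemma inj213 : injective (tnth [tuple o1; o0; o2]).
Proof. exact/tuple_uniqP. Qed.

Lemma inj231 : injective (tnth [tuple o1; o2; o0]).
Proof. exact/tuple_uniqP. Qed.

Definition pat213 : 'S_3 := perm inj213.
Definition pat231 : 'S_3 := perm inj231.

Lemma pat213_one_line : [seq (val (pat213 i)).+1 | i <- enum 'I_3] = [:: 2; 1; 3].
Proof.
rewrite (eq_map (g := fun i => (val (tnth [tuple o1; o0; o2] i)).+1)).
  by rewrite !enum_ordSl enum_ord0.
by move=> i; rewrite /= permE.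
Qed.

Lemma pat231_one_line : [seq (val (pat231 i)).+1 | i <- enum 'I_3] = [:: 2; 3; 1].
Proof.
rewrite (eq_map (g := fun i => (val (tnth [tuple o1; o2; o0] i)).+1)).
  by rewrite !enum_ordSl enum_ord0.
by move=> i; rewrite /= permE.
Qed.

Definition A (n : nat) : {set 'S_n} :=
  [set pi : 'S_n | avoids pat213 pi && avoids pat231 pi].

(* An increasing subsequence is given by its set S of positions. *)
Definition increasing_on (n : nat) (pi : 'S_n) (S : {set 'I_n}) : bool :=
  [forall i : 'I_n in S, forall j : 'I_n in S, (i < j) ==> (pi i < pi j)].

Definition lis (n : nat) (pi : 'S_n) : nat :=
  \max_(S : {set 'I_n} | increasing_on pi S) #|S|.

(* Main.v *)
Require Import Defs.
From mathcomp Require Import all_boot all_order all_fingroup all_algebra.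
From mathcomp Require Import ring.

Set Implicit Arguments.
Unset Strict Implicit.
Unset Printing Implicit Defensive.

Import GRing.Theory.
Local Open Scope ring_scope.

(** A permutation avoids 213 and 231 iff no entry lies strictly between two
    later ones in value, i.e. iff every entry is the minimum or the maximum of
    the entries from its position on.  Deleting the first entry thus maps
    [A n.+1] two-to-one onto [A n] when [1 <= n].  A leading minimum keeps the
    sign and adds 1 to lis; a leading maximum multiplies the sign by
    [(-1) ^+ n] and keeps lis.  So the generating polynomial is multiplied by
    ['X + (-1) ^+ n], and evaluating it at 1 compares the two parities. *)

Lemma ltn_lift n (h : 'I_n) (i j : 'I_n.-1) : (lift h i < lift h j)%N = (i < j)%N.
Proof. by rewrite !ltnNge leq_bump2. Qed.

Lemma lift_perm_inj n (i j : 'I_n.+1) : injective (lift_perm i j).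
Proof.
move=> s t est; apply/permP=> k.
by apply: (@lift_inj _ j); rewrite -!(lift_perm_lift i) est.
Qed.

(** This makes deletion of the entry at position [i] precise: by injectivity no other position takes
    the value [s i], so the remaining values factor through [lift (s i)]. *)
Lemma lift_permP n (i : 'I_n.+1) (s : 'S_n.+1) :
  exists t : 'S_n, s = lift_perm i (s i) t.
Proof.
have [k|f fE] := fin_all_exists (P := fun k k' => s (lift i k) = lift (s i) k').
  case: (unliftP (s i) (s (lift i k))) => [k' ->|]; first by exists k'.
  by move/perm_inj/eqP; rewrite eq_sym (negPf (neq_lift _ _)).
have f_inj : injective f.
  by move=> k l /(congr1 (lift (s i))); rewrite -!fE => /perm_inj/lift_inj.
exists (perm f_inj); apply/permP=> k.
case: (unliftP i k) => [k'|] ->; last by rewrite lift_perm_id.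
by rewrite lift_perm_lift permE fE.
Qed.

Lemma avoidsPn k n (tau : 'S_k) (pi : 'S_n) :
  reflect (exists f : 'I_k -> 'I_n, forall i j : 'I_k,
             ((i < j)%N -> (f i < f j)%N) /\
             (pi (f i) < pi (f j))%N = (tau i < tau j)%N)
          (~~ avoids tau pi).
Proof.
rewrite negbK; apply: (iffP existsP) => [[f /'forall_forallP fP]|[f fP]].
  by exists f => i j; have /andP[/implyP ? /eqP] := fP i j.
exists (finfun f); apply/'forall_forallP => i j; rewrite !ffunE.
by have [/implyP-> ->] := fP i j; rewrite eqxx.
Qed.

(** Applied twice, it splits a claim about two pattern indices into nine closed cases, in which
    [tnth] computes. *)
Lemma ord3P (P : 'I_3 -> Prop) : P o0 -> P o1 -> P o2 -> forall i, P i.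
Proof.
move=> P0 P1 P2 [[|[|[|//]]] lti].
- by rewrite (_ : Ordinal lti = o0) //; apply: val_inj.
- by rewrite (_ : Ordinal lti = o1) //; apply: val_inj.
- by rewrite (_ : Ordinal lti = o2) //; apply: val_inj.
Qed.

(** Both patterns start with their middle value and differ only in the order of the two later
    entries. Forbidding both therefore leaves the order of [j] and [k] free. *)
Lemma in_A n (pi : 'S_n) :
  reflect (forall i j k : 'I_n, (i < j)%N -> (i < k)%N ->
             ~~ ((pi j < pi i) && (pi i < pi k))%N)
          (pi \in A n).
Proof.
rewrite inE; apply: (iffP andP) => [[av213 av231] i j k ltij ltik|avA].
  apply/negP => /andP[ltji ltik'].
  have ltjk' := ltn_trans ltji ltik'.
  case: (ltngtP j k) => [ltjk|ltkj|/val_inj ejk].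
  - move/avoidsPn: av213; apply; exists (tnth [tuple i; j; k]).
    by apply: ord3P; apply: ord3P; split => //;
      rewrite !permE /= ?ltnn ?ltji ?ltik' ?ltjk' // ltnNge ltnW.
  - move/avoidsPn: av231; apply; exists (tnth [tuple i; k; j]).
    by apply: ord3P; apply: ord3P; split => //;
      rewrite !permE /= ?ltnn ?ltji ?ltik' ?ltjk' // ltnNge ltnW.
  - by rewrite ejk ltnn in ltjk'.
split; rewrite -[avoids _ _]negbK; apply/negP => /avoidsPn[f fP].
  apply/negP: (avA (f o0) (f o1) (f o2) ((fP o0 o1).1 isT) ((fP o0 o2).1 isT)).
  by rewrite (fP o1 o0).2 (fP o0 o2).2 !permE.
apply/negP: (avA (f o0) (f o2) (f o1) ((fP o0 o2).1 isT) ((fP o0 o1).1 isT)).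
by rewrite (fP o2 o0).2 (fP o0 o1).2 !permE.
Qed.

(** A forbidden triple starting at position 0 would need values on both sides of [j], which an
    extreme value excludes; all other triples come from [s]. *)
Lemma lift_perm_in_A n (j : 'I_n.+1) (s : 'S_n) :
  j \in [:: ord0; ord_max] -> (lift_perm ord0 j s \in A n.+1) = (s \in A n).
Proof.
move=> j_ext; apply/in_A/in_A => avs.
  move=> a b c ltab ltac.
  have := avs (lift ord0 a) (lift ord0 b) (lift ord0 c).
  by rewrite !lift_perm_lift !ltn_lift; apply.
move=> a b c.
case: (unliftP ord0 b) => [b'|] -> //; case: (unliftP ord0 c) => [c'|] -> //.
case: (unliftP ord0 a) => [a'|] ->.
  by rewrite !lift_perm_lift !ltn_lift; apply: avs.
move=> _ _; rewrite lift_perm_id; move: j_ext; rewrite !inE => /orP[]/eqP -> //.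
by rewrite negb_and -!leqNgt; apply/orP; right; apply: leq_ord.
Qed.

(** Otherwise the minimum and the maximum both sit at later positions, and their values enclose the
    first entry. *)
Lemma A_first n (s : 'S_n.+1) : s \in A n.+1 -> s ord0 \in [:: ord0; ord_max].
Proof.
move/in_A => avs; rewrite !inE; apply/norP => -[s0 sm].
have pos x : s ord0 != x -> (0 < (s^-1)%g x)%N.
  by rewrite lt0n; apply: contraNN => /eqP/(@val_inj _ _ _ _ ord0) <-; rewrite permKV.
have := avs ord0 _ _ (pos _ s0) (pos _ sm).
have lem : (s ord0 <= @ord_max n)%N by exact: leq_ord.
by rewrite !permKV lt0n s0 /= ltn_neqAle sm lem.
Qed.

Lemma A_rec n : A n.+2 = lift_perm ord0 ord0 @: A n.+1
                         :|: lift_perm ord0 ord_max @: A n.+1.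
Proof.
apply/setP=> s; rewrite in_setU; apply/idP/orP => [sA|]; last first.
  by case=> /imsetP[t tA ->]; rewrite lift_perm_in_A // !inE eqxx ?orbT.
have [t st] := lift_permP ord0 s; have s_ext := A_first sA.
rewrite st lift_perm_in_A // in sA.
move: s_ext; rewrite !inE => /orP[]/eqP s0; [left | right];
  by apply/imsetP; exists t; rewrite // {1}st s0.
Qed.

Lemma increasing_onP n (pi : 'S_n) (S : {set 'I_n}) :
  reflect {in S &, forall i j : 'I_n, (i < j)%N -> (pi i < pi j)%N}
          (increasing_on pi S).
Proof.
apply: (iffP 'forall_in_'forall_in_implyP) => inc i j; first by move=> ? ?; apply: inc.
by move=> ?; apply: inc.
Qed.

Lemma lis_geq n (pi : 'S_n) (S : {set 'I_n}) :
  increasing_on pi S -> (#|S| <= lis pi)%N.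
Proof. exact: leq_bigmax_cond. Qed.

Lemma lis_witness n (pi : 'S_n) : exists2 S, increasing_on pi S & #|S| = lis pi.
Proof.
have [|S incS eS] := @eq_bigmax_cond _ (increasing_on pi) (fun S => #|S|).
  apply/card_gt0P; exists set0; apply/increasing_onP => i j.
  by rewrite inE.
by exists S.
Qed.

Lemma lis_gt0 n (pi : 'S_n.+1) : (0 < lis pi)%N.
Proof.
rewrite -(cards1 (@ord0 n)); apply/lis_geq/increasing_onP => i j.
by rewrite !inE => /eqP-> /eqP->.
Qed.

Lemma increasing_on_preim n (j : 'I_n.+1) (s : 'S_n) (S : {set 'I_n.+1}) :
  increasing_on (lift_perm ord0 j s) S -> increasing_on s (lift ord0 @^-1: S).
Proof.
move/increasing_onP=> incS; apply/increasing_onP => a b; rewrite !inE => aS bS.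
by rewrite -(ltn_lift ord0) => /(incS _ _ aS bS); rewrite !lift_perm_lift ltn_lift.
Qed.

Lemma increasing_on_im n (j : 'I_n.+1) (s : 'S_n) (S : {set 'I_n}) :
  increasing_on s S -> increasing_on (lift_perm ord0 j s) (lift ord0 @: S).
Proof.
move/increasing_onP=> incS; apply/increasing_onP => _ _ /imsetP[a aS ->] /imsetP[b bS ->].
by rewrite !lift_perm_lift !ltn_lift; apply: incS.
Qed.

Lemma card_preim_lift0 n (S : {set 'I_n.+1}) :
  #|S| = ((ord0 \in S) + #|lift ord0 @^-1: S|)%N.
Proof.
rewrite (cardsD1 ord0) -(card_imset _ (@lift_inj _ ord0)); congr (_ + #|pred_of_set _|)%N.
apply/setP=> k; rewrite !inE; case: (unliftP ord0 k) => [k'|] ->.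
  by rewrite eq_sym neq_lift mem_imset ?inE //; apply: lift_inj.
by rewrite eqxx; apply/esym/imsetP => -[k' _ /eqP]; rewrite (negPf (neq_lift _ _)).
Qed.

(** Position 0 carries the least value, so it can be added to any increasing set; conversely,
    removing it costs at most one element. *)
Lemma lis_lift_min n (s : 'S_n) : lis (lift_perm ord0 ord0 s) = (lis s).+1.
Proof.
apply/eqP; rewrite eqn_leq; apply/andP; split.
  apply/bigmax_leqP => S /increasing_on_preim/lis_geq leS.
  by rewrite card_preim_lift0; apply: leq_add (leq_b1 _) leS.
have [S incS <-] := lis_witness s.
have S0 : ord0 \notin lift ord0 @: S.
  by apply/imsetP => -[k' _ /eqP]; rewrite (negPf (neq_lift _ _)).
have := cardsU1 ord0 (lift ord0 @: S).
rewrite S0 (card_imset _ (@lift_inj _ ord0)) add1n => <-.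
apply/lis_geq/increasing_onP => a b.
have /increasing_onP inc := increasing_on_im ord0 incS.
rewrite !in_setU1 => /predU1P[->|aS] /predU1P[->|bS] //; last exact: inc.
by case/imsetP: bS => b' _ ->; rewrite lift_perm_id lift_perm_lift.
Qed.

(** An increasing set through position 0 is a singleton, since nothing exceeds the maximum. Its size
    1 is at most [lis s] because [s] has at least one entry. *)
Lemma lis_lift_max n (s : 'S_n.+1) : lis (lift_perm ord0 ord_max s) = lis s.
Proof.
apply/eqP; rewrite eqn_leq; apply/andP; split.
  apply/bigmax_leqP => S incS; rewrite card_preim_lift0.
  case: (boolP (ord0 \in S)) => [S0|_]; last exact/lis_geq/increasing_on_preim/incS.
  rewrite (_ : _ @^-1: _ = set0) ?cards0 ?lis_gt0 //.
  apply/setP=> k; rewrite !inE; apply/negP => kS.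
  have /increasing_onP/(_ _ _ S0 kS isT) := incS.
  by rewrite lift_perm_id ltnNge leq_ord.
have [S incS <-] := lis_witness s.
by rewrite -(card_imset _ (@lift_inj _ ord0)) lis_geq // increasing_on_im.
Qed.

Definition genpoly n : {poly int} :=
  \sum_(pi in A n) (-1) ^+ odd_perm pi * 'X^(lis pi).

Lemma genpoly1 : genpoly 1 = 'X.
Proof.
have perm1E (s : 'S_1) : s = 1%g by apply/permP=> i; rewrite !ord1.
rewrite /genpoly (big_pred1 1%g) => [|s]; last first.
  by rewrite (perm1E s) /= eqxx; apply/in_A => i j; rewrite !ord1.
rewrite odd_perm1 mul1r (_ : lis _ = 1%N) //.
apply/eqP; rewrite eqn_leq lis_gt0 andbT; apply/bigmax_leqP => S _.
by rewrite (leq_trans (max_card _)) ?card_ord.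
Qed.

Lemma genpolyS n : genpoly n.+2 = ('X + (-1) ^+ n.+1) * genpoly n.+1.
Proof.
rewrite /genpoly A_rec (eq_bigl _ _ (fun s => in_setU s _ _)) bigU /=; last first.
  (* The two images are disjoint: their first entries are [ord0] and [ord_max], which differ in
     ['I_n.+2]. *)
  rewrite -setI_eq0; apply/eqP/setP=> s; rewrite !inE; apply/negP.
  case/andP=> /imsetP[t _ ->] /imsetP[u _ /permP/(_ ord0)].
  by rewrite !lift_perm_id.
rewrite !big_imset; try by move=> s t _ _; apply: lift_perm_inj.
(* Prepending the value [j] shifts the parity by that of [j], which is 0 for [ord0] and [n.+1] for
   [ord_max]. *)
rewrite mulrDl !big_distrr /=; congr (_ + _); apply: eq_bigr => s _.
  by rewrite lis_lift_min odd_lift_perm exprS mulrCA.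
by rewrite lis_lift_max odd_lift_perm signr_addb signr_odd mulrA.
Qed.

(** The factors ['X + (-1) ^+ k] for [k] from 1 to [n] are ['X - 1] for odd [k] and ['X + 1] for
    even [k]; the exponents count these. *)
Lemma genpolyE n :
  genpoly n.+1 = 'X * ('X + 1) ^+ (n %/ 2)%N * ('X - 1) ^+ (n.+1 %/ 2)%N.
Proof.
elim: n => [|n IHn]; first by rewrite genpoly1 !mulr1.
rewrite genpolyS IHn -signr_odd !divn2 /= uphalf_half.
by case: (odd n); rewrite /= ?add1n ?add0n ?expr0 ?expr1 !exprS; ring.
Qed.

(** At 1 every power of ['X] becomes 1, so only the signs remain, whatever [f] is. *)
Lemma horner1_sum_sign n (f : 'S_n -> nat) (B : {set 'S_n}) :
  (\sum_(pi in B) (-1) ^+ odd_perm pi * 'X^(f pi) : {poly int}).[1]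
    = #|[set pi in B | ~~ odd_perm pi]|%:R - #|[set pi in B | odd_perm pi]|%:R.
Proof.
rewrite horner_sum -!sum1_card !natr_sum big_mkcond.
rewrite [X in _ = X - _]big_mkcond [X in _ = _ - X]big_mkcond -sumrB.
apply: eq_bigr => pi _; rewrite !inE.
case: (pi \in B); last by rewrite subrr.
by case: (odd_perm pi); rewrite !hornerE expr1n.
Qed.

Theorem corollary5p3 (n : nat) (hn : (1 <= n)%N) :
  (\sum_(pi in A n) (-1) ^+ odd_perm pi * 'X^(lis pi) : {poly int})
    = 'X * ('X + 1) ^+ ((n - 1) %/ 2)%N * ('X - 1) ^+ (n %/ 2)%N
  /\ ((2 <= n)%N ->
      #|[set pi in A n | ~~ odd_perm pi]| = #|[set pi in A n | odd_perm pi]|).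
Proof.
case: n hn => // n _; rewrite subn1 /=; split=> [|n_ge2]; first exact: genpolyE.
move/(congr1 (horner^~ 1)): (genpolyE n).
(* From size 2 on, the exponent of ['X - 1] is positive, so the product vanishes at 1. In size 1 the
   only permutation is the identity, which is even. *)
rewrite horner1_sum_sign !hornerE subrr expr0n eqn0Ngt divn_gt0 // n_ge2 mulr0.
by move/eqP; rewrite subr_eq0 Num.Theory.eqr_nat => /eqP.
Qed.
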